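(* Let $X$ be a uniformly perfect metric space with more than one point, let $\Phi$ and $\Phi_1$ be admissible functions, and let $F\subseteq X$ be non-empty and totally bounded with $0<\dim_{\mathrm A}F<\infty$ and such that the closure $\overline F$ is complete. Suppose that $0<\overline{\dim}^\Phi F<\dim_{\mathrm A}F$ and let $\eta\in[0,\dim_{\mathrm A}F-\overline{\dim}^\Phi F)$. Define $$\gamma:=\frac{\overline{\dim}^\Phi F-\dim_{\mathrm L}F}{\overline{\dim}^\Phi F+\eta-\dim_{\mathrm L}F},\qquad \alpha:=\frac{\dim_{\mathrm A}F-\overline{\dim}^\Phi F}{\dim_{\mathrm A}F-\overline{\dim}^\Phi F-\eta}.$$ If $$\Phi_1(\delta)\le\left(\Phi(\delta^{1/\alpha})\right)^{\gamma}$$ for all sufficiently small $\delta>0$, then $\overline{\dim}^{\Phi_1}F\le\overline{\dim}^\Phi F+\eta$. The same holds with $\overline{\dim}$ replaced by $\underline{\dim}$ throughout.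
   Context: For a subset $U$ of a metric space, $|U|$ denotes its diameter, and $B(x,r)$ is the open ball. Convention: $\inf\varnothing=\infty$. A metric space $X$ is uniformly perfect if there is $c\in(0,1)$ such that $B(x,R)\setminus B(x,cR)\neq\varnothing$ for all $x\in X$ and $0<R<|X|$. $N_\delta(F)$ is the smallest number of open balls of radius $\delta/2$ with centres in $F$ needed to cover $F$; $F$ is totally bounded if $N_\delta(F)<\infty$ for all $\delta>0$. A function $\Phi\colon(0,\Delta)\to\mathbb{R}$ (for some $\Delta>0$) is admissible if it is monotonic, $0<\Phi(\delta)\le\delta$ for all $\delta\in(0,\Delta)$, and $\Phi(\delta)/\delta\to0$ as $\delta\to0^+$. For a non-empty totally bounded $F\subseteq X$ and admissible $\Phi$, the upper $\Phi$-intermediate dimension $\overline{\dim}^\Phi F$ is the infimum of all $s\ge0$ such that for all $\epsilon>0$ there exists $\delta_0\in(0,1]$ such that for all $\delta\in(0,\delta_0)$ there is a cover $\{U_1,U_2,\dots\}$ of $F$ with $\Phi(\delta)\le|U_i|\le\delta$ for all $i$ and $\sum_i|U_i|^s\le\epsilon$. The lower $\Phi$-intermediate dimension $\underline{\dim}^\Phi F$ is the infimum of all $s\ge0$ such that for all $\epsilon>0$ and $\delta_0\in(0,1]$ there exist $\delta\in(0,\delta_0)$ and a cover $\{U_1,U_2,\dots\}$ of $F$ with $\Phi(\delta)\le|U_i|\le\delta$ for all $i$ and $\sum_i|U_i|^s\le\epsilon$. (Here $\delta$ is understood to lie in the domain of $\Phi$.) For $F$ with more than one point, the Assouad dimension $\dim_{\mathrm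 A}F$ is the infimum of all $a$ for which there exists $C>0$ such that $N_r(B(x,R)\cap F)\le C(R/r)^a$ for all $x\in F$ and $0<r<R$. The lower dimension $\dim_{\mathrm L}F$ is the supremum of all $\lambda$ for which there exists $C>0$ such that $N_r(B(x,R)\cap F)\ge C(R/r)^\lambda$ for all $x\in F$ and $0<r<R\le|F|$.
   Formalization: The theorem additionally assumes that the lower dimension of F differs from its (upper, resp. lower) Φ-intermediate dimension, since otherwise γ is 0/0 for η = 0, and for η > 0 γ = 0 makes the condition on Φ₁ vacuous and the claim false. *)

(* Defs.v *)
From mathcomp Require Import all_boot all_order all_algebra.
From mathcomp Require Import all_classical all_reals all_analysis.

Set Implicit Arguments.
Unset Strict Implicit.
Unset Printing Implicit Defensive.

Import Order.TTheory GRing.Theory Num.Theory.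
Import numFieldNormedType.Exports.

Local Open Scope classical_set_scope.
Local Open Scope ring_scope.

Section metric_notions.
Context {R : realType} {X : metricType R}.
Implicit Types (F U : set X) (x : X).

(* The supremum is taken together with 0, so that the empty set has diameter 0
   (the supremum of the empty set in \bar R is -oo). *)
Definition diam U : \bar R :=
  ereal_sup (0%E |` [set (mdist z.1 z.2)%:E | z in U `*` U]).

(* The centres must lie in F; the value is +oo when no finite family of balls
   covers F. *)
Definition covering_number (delta : R) F : \bar R :=
  ereal_inf [set (size s)%:R%:E | s in
    [set s : seq X | [set` s] `<=` F /\
                     F `<=` \bigcup_(x in [set` s]) ball x (delta / 2)]].

Definition totally_bounded F :=
  forall delta : R, 0 < delta -> (covering_number delta F < +oo)%E.

Definition complete_set F := forall u : nat -> X,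
  (forall n, F (u n)) -> cauchy (u @ \oo) -> exists2 x, F x & u @ \oo --> x.

Definition assouad_dim F : \bar R :=
  ereal_inf [set a%:E | a in [set a : R | exists2 C : R, 0 < C &
    forall (x : X) (r rho : R), F x -> 0 < r -> r < rho ->
      (covering_number r (ball x rho `&` F) <= (C * (rho / r) `^ a)%:E)%E]].

Definition lower_dim F : \bar R :=
  ereal_sup [set l%:E | l in [set l : R | exists2 C : R, 0 < C &
    forall (x : X) (r rho : R), F x -> 0 < r -> r < rho ->
      (rho%:E <= diam F)%E ->
      ((C * (rho / r) `^ l)%:E <= covering_number r (ball x rho `&` F))%E]].

End metric_notions.

Definition uniformly_perfect {R : realType} (X : metricType R) :=
  exists2 c : R, 0 < c < 1 &
    forall (x : X) (rho : R), 0 < rho -> (rho%:E < diam [set: X])%E ->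
      ball x rho `\` ball x (c * rho) !=set0.

(* A function Phi : (0, Delta) -> R is encoded as a total function on R
   together with Delta; its values outside (0, Delta) are irrelevant. *)
Definition admissible {R : realType} (Delta : R) (Phi : R -> R) :=
  [/\ 0 < Delta,
      {in `]0, Delta[ &, {homo Phi : x y / x <= y}} \/
      {in `]0, Delta[ &, {homo Phi : x y /~ x <= y}},
      (forall delta, 0 < delta < Delta -> 0 < Phi delta <= delta) &
      Phi delta / delta @[delta --> 0^'+] --> (0 : R)].

Section intermediate_dimensions.
Context {R : realType} {X : metricType R}.
Variables (Delta : R) (Phi : R -> R).
Implicit Types (F : set X) (s eps delta : R).

(* The index set I may be any set of natural numbers, so that both finite and
   countably infinite covers are allowed. *)
Definition has_cover F s eps delta := exists (I : set nat) (U : nat -> set X),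
  [/\ F `<=` \bigcup_(i in I) U i,
      (forall i, I i -> ((Phi delta)%:E <= diam (U i) <= delta%:E)%E) &
      (\esum_(i in I) (diam (U i) `^ s) <= eps%:E)%E].

Definition upper_phi_dim F : \bar R :=
  ereal_inf [set s%:E | s in [set s : R | 0 <= s /\
    forall eps, 0 < eps -> exists2 delta0 : R, 0 < delta0 <= 1 &
      forall delta, 0 < delta < delta0 -> delta < Delta ->
        has_cover F s eps delta]].

Definition lower_phi_dim F : \bar R :=
  ereal_inf [set s%:E | s in [set s : R | 0 <= s /\
    forall eps delta0, 0 < eps -> 0 < delta0 <= 1 ->
      exists delta, [/\ 0 < delta < delta0, delta < Delta &
        has_cover F s eps delta]]].

End intermediate_dimensions.

(* Main.v *)
(** Fix delta, put delta' = delta^(1/alpha), and take a cover of F by sets of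
diameter in [Phi delta', delta'] with finite sum; the diameters being bounded
below, the cover is finite.  Put rho = Phi1 delta.  A set of diameter at
least rho is replaced, together with its rho-neighbourhood in F, by balls of
radius comparable to min(diameter, delta); the Assouad dimension bounds their
number.  On the remaining part of F take a maximal 4 rho-separated family.  Each
ball of radius rho around one of its points is covered by sets smaller than rho
alone, so for lam below the lower dimension these sets satisfy
sum |U|^lam >= c rho^lam, and the balls do not share such sets; this bounds the
size of the family.  Uniform perfectness keeps the diameter of a ball comparable
to its radius.  The exponents alpha and gamma are those for which the two costs
are controlled by the cost of the original cover. *)

Require Import Defs.
From mathcomp Require Import all_boot all_order all_algebra.
From mathcomp Require Import finmap.
From mathcomp Require Import all_classical all_reals all_analysis.
From mathcomp Require Import ring lra.

Import Order.TTheory GRing.Theory Num.Theory.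
Import numFieldNormedType.Exports.

Local Open Scope classical_set_scope.
Local Open Scope ring_scope.

(** No index is selected by two entries related by [d], so each index counts at most once. The
    induction takes the indices of the head out of [P] before treating the tail. *)
Lemma sum_pairwise_disjoint {R : numDomainType} {I J : eqType} (d : rel J)
    (r : seq I) (f : I -> R) (s : seq J) (Q : J -> pred I) (P : pred I) :
  (forall i, 0 <= f i) -> pairwise d s ->
  (forall j k i, j \in s -> d j k -> i \in r -> Q j i -> ~~ Q k i) ->
  (forall j i, j \in s -> i \in r -> Q j i -> P i) ->
  \sum_(j <- s) \sum_(i <- r | Q j i) f i <= \sum_(i <- r | P i) f i.
Proof.
move=> f0; elim: s P => [|j s IH] P /=; first by rewrite big_nil sumr_ge0.
move=> /andP[/allP dj ds] dQ QP.
rewrite big_cons (bigID (Q j) P) /= lerD//.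
  rewrite big_seq_cond [leRHS]big_seq_cond.
  rewrite [leRHS](eq_bigl (fun i => (i \in r) && Q j i))//.
  move=> i /=; case: (boolP (i \in r)) => //= ir.
  have := QP j i (mem_head _ _) ir; case: (Q j i) => [->//|_].
  by rewrite andbF.
apply: IH => // [k l i ks|k i ks ir Qki]; first by apply: dQ; rewrite inE ks orbT.
apply/andP; split.
  by apply: QP Qki => //; rewrite inE ks orbT.
by apply/negP => /(dQ j k i (mem_head _ _) (dj k ks) ir); rewrite Qki.
Qed.

Lemma sum_const_seq {R : pzSemiRingType} (J : Type) (s : seq J) (K : R) :
  \sum_(j <- s) K = (size s)%:R * K.
Proof. by rewrite big_const_seq count_predT iter_addr_0 mulr_natl. Qed.

(** * Separated families and lower bounds for covers of balls *)

Section metric_lemmas.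
Context {R : realType} {X : metricType R}.
Implicit Types (F G U : set X) (x y : X).

Lemma in_ball x y (r : R) : ball x r y <-> mdist x y < r.
Proof. by rewrite ballEmdist. Qed.

(** Greedy choice, stopped after [n] points. A net is obtained without knowing beforehand that
    separated families are finite: it suffices to take [n] beyond an a priori bound on their
    size. *)
Lemma separated_or_maximal G (T : R) (n : nat) : 0 < T ->
  exists s : seq X, [/\ [set` s] `<=` G,
    pairwise (fun x y => T <= mdist x y) s &
    size s = n \/ forall x, G x -> exists2 y, y \in s & mdist y x < T].
Proof.
move=> T0; elim: n => [|n [s [sG ss [sn|smax]]]].
- by exists [::]; split => //; left.
- have [smax|] := pselect (forall x, G x -> exists2 y, y \in s & mdist y x < T).
    by exists s; split => //; right.
  move=> /existsNP[x /not_implyP[Gx /forall2NP xs]].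
  exists (x :: s); split => /=; last by left; rewrite sn.
  + by move=> y /=; rewrite inE => /orP[/eqP->//|/sG].
  + rewrite ss andbT; apply/allP => y ys.
    have [//|/negP] := xs y; rewrite -leNgt.
    by rewrite metric_sym.
- by exists s; split => //; right.
Qed.

Lemma diam_le U (r : R) : 0 <= r ->
  (forall x y, U x -> U y -> mdist x y <= r) -> (diam U <= r%:E)%E.
Proof.
move=> r0 Ur; apply: ge_ereal_sup => _ [->|[[x y] [/= Ux Uy]] <-].
  by rewrite lee_fin.
by rewrite lee_fin Ur.
Qed.

Lemma mdist_diam U x y : U x -> U y -> ((mdist x y)%:E <= diam U)%E.
Proof.
by move=> Ux Uy; apply: ereal_sup_ubound; right; exists (x, y).
Qed.

Lemma diam_ball (c : R) x (u : R) : 0 < u -> (u%:E < diam [set: X])%E ->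
  ball x u `\` ball x (c * u) !=set0 ->
  ((c * u)%:E <= diam (ball x u) <= (2 * u)%:E)%E.
Proof.
move=> u0 uX [y [xy /in_ball/negP]]; rewrite -leNgt => cxy; apply/andP; split.
  apply: (@le_trans _ _ (mdist x y)%:E); first by rewrite lee_fin.
  by apply: mdist_diam => //; exact: ballxx.
apply: diam_le => [|a b /in_ball xa /in_ball xb]; first by lra.
have := metric_triangle a x b; rewrite (metric_sym a x); lra.
Qed.

(** A maximal [4 * (t * rho)]-separated family is a net, so its size is at least a covering number,
    which the lower dimension bounds below with some exponent [l > lam]. The gap [l - lam] absorbs
    the constants once [t] is small. The last inequality says that passing from a ball to these
    smaller balls does not decrease the sum of the radii to the power [lam]. *)
Lemma lower_content_step F (lam : R) : 0 < lam -> (lam%:E < lower_dim F)%E ->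
  exists2 t : R, 0 < t <= 4^-1 &
    forall x (rho : R), F x -> 0 < rho -> (rho%:E <= diam F)%E ->
    exists s : seq X, [/\ [set` s] `<=` ball x (rho / 2) `&` F,
      pairwise (fun y z => 4 * (t * rho) <= mdist y z) s &
      1 <= (size s)%:R * t `^ lam].
Proof.
move=> lam0 /ereal_sup_gt[_ [l [C C0 FC] <-]]; rewrite lte_fin => laml.
have l0 : 0 < l by lra.
have [t [t0 t1 tC]] : exists t : R, [/\ 0 < t, t < 16^-1 &
    t `^ (l - lam) <= C * 16^-1 `^ l].
  have K0 : 0 < C * 16^-1 `^ l by rewrite mulr_gt0// powR_gt0//; lra.
  set K := _ * _ in K0 *.
  have -> : K = (K `^ (l - lam)^-1) `^ (l - lam).
    by rewrite -powRrM mulVf ?powRr1 ?(ltW K0)// subr_eq0 gt_eqF.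
  (* The bound [17^-1] makes [t < 16^-1] strict, so that [8 * (t * rho) < rho / 2] are radii to
     which the lower dimension applies. *)
  pose v := Num.min 17^-1 (K `^ (l - lam)^-1).
  have v0 : 0 < v by rewrite lt_min powR_gt0//; lra.
  exists v; split => //; first by rewrite gt_min; apply/orP; left; lra.
  apply: ge0_ler_powR; rewrite ?nnegrE ?powR_ge0 ?(ltW v0)//; first by lra.
  by rewrite /v ge_min lexx orbT.
exists t; first by apply/andP; split; lra.
move=> x rho Fx rho0 rhoF.
have trho : 0 < t * rho by apply: mulr_gt0.
have tlam : 0 < t `^ lam by rewrite powR_gt0.
(* This [n] exceeds [(t ^ lam)^-1], so a family that reaches [n] points already satisfies the
   bound. *)
pose n := (Num.truncn (t `^ lam)^-1).+1.
have [s [sG ss smax]] := @separated_or_maximal (ball x (rho / 2) `&` F)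
  (4 * (t * rho)) n ltac:(lra).
exists s; split => //.
rewrite -ler_pdivrMr// mul1r.
case: smax => [->|smax]; first by rewrite ltW// /n truncnS_gt.
have r2 : (8 * (t * rho)) < rho / 2.
  have : t * rho < 16^-1 * rho by rewrite ltr_pM2r.
  lra.
have half : ((rho / 2)%:E <= diam F)%E.
  by apply: le_trans rhoF; rewrite lee_fin; lra.
have := FC x (8 * (t * rho)) (rho / 2) Fx ltac:(lra) r2 half.
have : (covering_number (8 * (t * rho)) (ball x (rho / 2) `&` F) <= (size s)%:R%:E)%E.
  apply: ereal_inf_lbound; exists s => //; split => // y /smax[z zs zy].
  by exists z => //; apply/in_ball; lra.
move=> h1 h2; have := le_trans h2 h1; rewrite lee_fin; apply: le_trans.
have -> : rho / 2 / (8 * (t * rho)) = 16^-1 * t^-1.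
  by field; rewrite !gt_eqF.
rewrite powRM ?invr_ge0 ?(ltW t0)//.
rewrite -(powR_inv1 (ltW t0)) -powRrM mulN1r mulrA.
have -> : (t `^ lam)^-1 = t `^ (l - lam) * t `^ (- l).
  by rewrite -powRD ?(gt_eqF t0) ?implybT// -powRN; congr (_ `^ _); ring.
by rewrite ler_wpM2r ?powR_ge0.
Qed.

Lemma seq_lower_bound (J : eqType) (I : seq J) (w : J -> R) :
  (forall i, i \in I -> 0 < w i) ->
  exists2 v, 0 < v & forall i, i \in I -> v <= w i.
Proof.
elim: I => [|j I IH] w0; first by exists 1.
have [i iI|v v0 vI] := IH; first by apply: w0; rewrite inE iI orbT.
exists (Num.min v (w j)); first by rewrite lt_min v0 w0// mem_head.
move=> i; rewrite inE ge_min => /orP[/eqP->|/vI vi]; last by rewrite vi.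
by rewrite lexx orbT.
Qed.

(** A lower bound for the [lam]-dimensional Hausdorff content of balls in [F], for finite covers.
    Only the sets that meet the ball are counted, so that the bounds for well separated balls can be
    added. *)
Definition content_bound F (lam c : R) :=
  forall x (rho : R) (J : eqType) (I : seq J) (U : J -> set X) (w : J -> R),
    F x -> 0 < rho -> (rho%:E <= diam F)%E ->
    (forall y, ball x rho y -> F y -> exists2 i, i \in I & U i y) ->
    (forall i, i \in I -> 0 < w i) ->
    (forall i y z, i \in I -> U i y -> U i z -> mdist y z <= w i) ->
    c * rho `^ lam <=
      \sum_(i <- I | `[< U i `&` ball x rho !=set0 >]) w i `^ lam.

(* Finitely many sets of positive diameter admit a smallest scale, so an induction
   on the number of scales replaces a mass distribution. *)
Lemma lower_content F (lam : R) :
  lam = 0 \/ 0 < lam /\ (lam%:E < lower_dim F)%E ->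
  exists2 c : R, 0 < c & content_bound F lam c.
Proof.
have term (J : eqType) (I : seq J) (P : pred J) (f : J -> R) i :
    i \in I -> P i -> (forall i, 0 <= f i) -> f i <= \sum_(i <- I | P i) f i.
  by move=> iI Pi f0; rewrite (big_rem i iI) /= Pi lerDl sumr_ge0.
case=> [->|[lam0 lamF]].
  (* With exponent 0 every set has weight 1, and some set contains the centre. *)
  exists 1 => // x rho J I U w Fx rho0 _ cov _ _.
  have [i iI Ui] := cov x (ballxx x rho0) Fx.
  rewrite powRr0 mulr1 -[leLHS](powRr0 (w i)).
  apply: (term _ _ _ (fun i => w i `^ 0)) => // [|j]; last exact: powR_ge0.
  by apply/asboolP; exists x; split => //; exact: ballxx.
have [t /andP[t0 t4] tF] := lower_content_step F lam lam0 lamF.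
have t1 : t < 1 by lra.
exists (t `^ lam); first exact: powR_gt0.
move=> x rho J I U w Fx rho0 rhoF cov w0 diamU.
have [v v0 vw] := seq_lower_bound _ I w w0.
have [m tm] : exists m : nat, t ^+ m * rho <= v.
  have t1' : `|t| < 1 by rewrite gtr0_norm.
  have /cvgrPdist_lt/(_ (v / rho)) := cvg_expr t1'.
  rewrite divr_gt0// => /(_ isT)/filter_ex[m].
  rewrite sub0r normrN normrX gtr0_norm// ltr_pdivlMr// => h.
  by exists m; exact: ltW.
have {v v0 vw tm} : forall i, i \in I -> t ^+ m * rho <= w i.
  by move=> i /vw; exact: le_trans.
(* A single set of weight at least [t * rho'] already contributes the whole bound. *)
have big x' (rho' : R) i : 0 < rho' -> i \in I -> (U i `&` ball x' rho') !=set0 ->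
    t * rho' <= w i -> t `^ lam * rho' `^ lam <=
      \sum_(i <- I | `[< U i `&` ball x' rho' !=set0 >]) w i `^ lam.
  move=> rho'0 iI iU tiw; rewrite -(powRM _ (ltW t0) (ltW rho'0)).
  apply: (@le_trans _ _ (w i `^ lam)).
    by rewrite ge0_ler_powR ?nnegrE ?mulr_ge0 ?(ltW t0) ?(ltW lam0) ?(ltW rho'0)
      ?(ltW (w0 i iI)).
  apply: (term _ _ _ (fun i => w i `^ lam)) => // [|j]; last exact: powR_ge0.
  exact/asboolP.
elim: m x rho Fx rho0 rhoF cov => [|m IH] x rho Fx rho0 rhoF cov tw.
all: have trho0 : 0 < t * rho by rewrite mulr_gt0.
(* At the smallest scale every weight is at least [rho], so the set containing the centre is large
   enough. *)
- have [i iI Ui] := cov x (ballxx x rho0) Fx.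
  apply: (big x rho i rho0 iI); first by exists x; split => //; exact: ballxx.
  by have := tw i iI; rewrite expr0; nra.
(* If no set meeting the ball is large, then each has weight below [t * rho] and cannot meet two of
   the sub-balls, whose centres are [4 * (t * rho)] apart. The induction hypotheses for the
   sub-balls then add up. *)
- have [[i [iI iU tiw]]|none] := pselect (exists i, [/\ i \in I,
      (U i `&` ball x rho) !=set0 & t * rho <= w i]).
    exact: (big x rho i).
  have [s [sF ss size_s]] := tF x rho Fx rho0 rhoF.
  have sub y : y \in s -> ball y (t * rho) `<=` ball x rho.
    move=> ys z /in_ball yz; apply/in_ball.
    have [/in_ball xy _] := sF y ys.
    by have := metric_triangle x y z; nra.
  apply: (@le_trans _ _ (\sum_(y <- s)
      \sum_(i <- I | `[< U i `&` ball y (t * rho) !=set0 >]) w i `^ lam)).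
    apply: (@le_trans _ _ (\sum_(y <- s) t `^ lam * (t * rho) `^ lam)).
      rewrite sum_const_seq (powRM _ (ltW t0) (ltW rho0)) mulrCA ler_wpM2l ?powR_ge0//.
      by rewrite mulrA ler_peMl ?powR_ge0.
    rewrite big_seq [leRHS]big_seq; apply: ler_sum => y ys.
    apply: IH => //.
    + by have [] := sF y ys.
    + by apply: le_trans rhoF; rewrite lee_fin; nra.
    + by move=> z /(sub y ys); exact: cov.
    + by move=> i /tw; rewrite exprS -mulrA mulrCA.
  apply: (@sum_pairwise_disjoint _ _ _ (fun y z => 4 * (t * rho) <= mdist y z))
    => //.
  + by move=> i; exact: powR_ge0.
  + move=> y z i ys yz iI /asboolP[p [Up /in_ball yp]].
    apply/asboolP => -[q [Uq /in_ball zq]].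
    have := diamU i p q iI Up Uq.
    have yx : ball x rho p by apply: (sub y ys p); exact/in_ball.
    have wt : w i < t * rho.
      rewrite ltNge; apply/negP => tw_i; apply: none; exists i; split => //.
      by exists p.
    have := metric_triangle y p z; have := metric_triangle p q z.
    by rewrite (metric_sym q z); lra.
  + move=> y i ys iI /asboolP[p [Up yp]]; apply/asboolP; exists p; split => //.
    exact: (sub y ys).
Qed.
End metric_lemmas.

(** * Passing between covers by sets and finite lists of balls *)

Section covers.
Context {R : realType} {X : metricType R}.
Implicit Types (F G U : set X) (x y : X).

(* The weights may exceed the diameters, so that they can be kept when the sets
   are intersected with F. *)
Definition finite_cover {J : eqType} F (I : seq J) (U : J -> set X)
    (w : J -> R) :=
  (forall y, F y -> exists2 i, i \in I & U i y) /\
  (forall i y z, i \in I -> U i y -> U i z -> mdist y z <= w i).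

(** Every term of the sum is at least [Phi delta ^ s > 0], so more than [eps / Phi delta ^ s] sets
    would exceed [eps]. *)
Lemma has_cover_finite (Phi : R -> R) F (s eps delta : R) :
  0 <= s -> 0 < Phi delta -> has_cover Phi F s eps delta ->
  exists (I : seq nat) (U : nat -> set X) (w : nat -> R),
    [/\ finite_cover F I U w, forall i, i \in I -> Phi delta <= w i <= delta &
        \sum_(i <- I) w i `^ s <= eps].
Proof.
move=> s0 Phi0 [A [U [FU UPhi sumU]]].
pose w i := fine (diam (U i)).
have wE i : A i -> diam (U i) = (w i)%:E.
  move=> /UPhi /andP[a b]; rewrite /w fineK//.
  by rewrite fin_real// (lt_le_trans _ a) ?ltNyr//= (le_lt_trans b) ?ltry.
have wP i : A i -> Phi delta <= w i <= delta.
  by move=> Ai; have := UPhi i Ai; rewrite wE// !lee_fin.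
have finA : finite_set A.
  apply: contrapT => infA.
  pose n := (Num.truncn (eps / Phi delta `^ s)).+1.
  have Ps0 : 0 < Phi delta `^ s by exact: powR_gt0.
  have [B BA nB] := infinite_set_fset n infA.
  have : ((n%:R * Phi delta `^ s)%:E <= eps%:E)%E.
    apply: le_trans sumU; apply: esum_ge; exists [set` B] => //.
    rewrite fsbig_finite//= set_fsetK.
    apply: (@le_trans _ _ (\sum_(i <- B) (Phi delta `^ s)%:E)%E).
      by rewrite sumEFin lee_fin sum_const_seq ler_wpM2r ?(ltW Ps0)// ler_nat.
    rewrite big_seq [leRHS]big_seq; apply: lee_sum => i iB.
    rewrite wE; last exact: BA.
    have /andP[Pw _] := wP i (BA i iB).
    by rewrite poweR_EFin lee_fin ge0_ler_powR// nnegrE ltW// (lt_le_trans Phi0).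
  by rewrite lee_fin -ler_pdivlMr// leNgt truncnS_gt.
have inA i : i \in fset_set A -> A i by rewrite in_fset_set// inE.
exists (fset_set A), U, w; split.
- split=> [y /FU[i Ai Uiy]|i y z /inA Ai Uy Uz].
    by exists i => //; rewrite in_fset_set// inE.
  by rewrite -lee_fin -wE//; exact: mdist_diam.
- by move=> i /inA /wP.
- rewrite -lee_fin -sumEFin; apply: le_trans sumU.
  rewrite esum_fset//; last by move=> i _; exact: poweR_ge0.
  rewrite fsbig_finite//= big_seq [leRHS]big_seq.
  by apply: lee_sum => i /inA Ai; rewrite wE.
Qed.

(** The entries are pairs of a centre and a radius. Twice the radius replaces the diameter, so that
    lists can be joined without computing diameters. *)
Definition ball_cover G (lo hi q K : R) := exists l : seq (X * R),
  [/\ forall y, G y -> exists2 p, p \in l & ball p.1 p.2 y,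
      forall p, p \in l -> lo <= p.2 <= hi &
      \sum_(p <- l) (2 * p.2) `^ q <= K].

Lemma ball_cover_sub G G' (lo hi q K K' : R) :
  G' `<=` G -> K <= K' -> ball_cover G lo hi q K -> ball_cover G' lo hi q K'.
Proof.
move=> G'G KK' [l [Gl lP lK]]; exists l; split => //; last exact: le_trans lK KK'.
by move=> y /G'G /Gl.
Qed.

Lemma ball_cover0 (lo hi q : R) : ball_cover set0 lo hi q 0.
Proof. by exists [::]; split => //; rewrite big_nil. Qed.

Lemma ball_coverU G G' (lo hi q K K' : R) :
  ball_cover G lo hi q K -> ball_cover G' lo hi q K' ->
  ball_cover (G `|` G') lo hi q (K + K').
Proof.
move=> [l [Gl lP lK]] [l' [Gl' lP' lK']]; exists (l ++ l'); split.
- move=> y [/Gl|/Gl'] [p pl py]; exists p => //; rewrite mem_cat pl ?orbT//.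
- by move=> p; rewrite mem_cat => /orP[/lP|/lP'].
- by rewrite big_cat lerD.
Qed.

Lemma ball_cover_bigcup (J : eqType) (I : seq J) (G : J -> set X)
    (lo hi q : R) (K : J -> R) :
  (forall i, i \in I -> ball_cover (G i) lo hi q (K i)) ->
  ball_cover [set y | exists2 i, i \in I & G i y] lo hi q (\sum_(i <- I) K i).
Proof.
elim: I => [|j I IH] GI.
  by rewrite big_nil; apply: ball_cover_sub (ball_cover0 lo hi q) => // y [].
rewrite big_cons; apply: ball_cover_sub (lexx _) (ball_coverU _ _ _ _ _ _ _
    (GI j (mem_head _ _)) (IH _)) => [y [i + Giy]|i iI].
  by rewrite inE => /orP[/eqP<-|iI]; [left|right; exists i].
by apply: GI; rewrite inE iI orbT.
Qed.

Lemma ball_cover_same_radius G (s : seq X) (u lo hi q : R) :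
  lo <= u <= hi -> (forall y, G y -> exists2 x, x \in s & ball x u y) ->
  ball_cover G lo hi q ((size s)%:R * (2 * u) `^ q).
Proof.
move=> uP Gs; exists [seq (x, u) | x <- s]; split.
- move=> y /Gs[x xs xy]; exists (x, u) => //.
  by apply/mapP; exists x.
- by move=> p /mapP[x _ ->].
- by rewrite big_map /= sum_const_seq.
Qed.

Lemma covering_number_lt (r K : R) G : (covering_number r G < K%:E)%E ->
  exists2 s : seq X, (forall y, G y -> exists2 x, x \in s & ball x (r / 2) y) &
    (size s)%:R <= K.
Proof.
move=> /ereal_inf_lt[_ [s [_ Gs] <-]]; rewrite lte_fin => /ltW sK.
by exists s.
Qed.

(** By uniform perfectness a ball of radius [u] has diameter between [c * u] and [2 * u]; this
    explains the range from [Phi delta / c] to [delta / 2] for the radii. The bound on [delta / 2]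
    makes perfectness available at all of them. *)
Lemma has_cover_balls (c : R) (Phi : R -> R) F (s eps delta : R) :
  (forall x (u : R), 0 < u -> (u%:E < diam [set: X])%E ->
    ball x u `\` ball x (c * u) !=set0) ->
  0 < c -> 0 <= s -> 0 < Phi delta -> ((delta / 2)%:E < diam [set: X])%E ->
  ball_cover F (Phi delta / c) (delta / 2) s eps ->
  has_cover Phi F s eps delta.
Proof.
move=> perf c0 s0 Phi0 dX [l [Fl lP lK]].
(* A point of [X] is needed as the default value of [nth]; if [X] is empty, the empty family is a
   cover. *)
have [x0|noX] := pselect (exists x0 : X, True); last first.
  exists set0, (fun _ => set0); split => //.
  - by move=> y; case: noX; exists y.
  - rewrite esum_set0 lee_fin; apply: le_trans lK.
    by apply: sumr_ge0 => *; exact: powR_ge0.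
have {x0} [x0 _] := x0.
pose U i := ball (nth (x0, 0) l i).1 (nth (x0, 0) l i).2.
have UP i : (i < size l)%N ->
    ((Phi delta)%:E <= diam (U i) <= delta%:E)%E /\
    (diam (U i) <= (2 * (nth (x0, 0) l i).2)%:E)%E.
  move=> il; have /andP[lo hi] := lP _ (mem_nth (x0, 0) il).
  rewrite /U; set p := nth _ _ _ in lo hi *.
  have p0 : 0 < p.2 by apply: lt_le_trans lo; exact: divr_gt0.
  have pX : (p.2%:E < diam [set: X])%E by apply: le_lt_trans dX; rewrite lee_fin.
  have /andP[d1 d2] := diam_ball c p.1 p.2 p0 pX (perf p.1 p.2 p0 pX).
  split => //; apply/andP; split.
    by apply: le_trans d1; rewrite lee_fin mulrC -ler_pdivrMr.
  by apply: le_trans d2 _; rewrite lee_fin; lra.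
exists `I_(size l), U; split.
- move=> y /Fl[p pl py]; exists (index p l); first by rewrite /= index_mem.
  by rewrite /U nth_index.
- by move=> i /UP[].
- rewrite esum_fset//; last by move=> i _; exact: poweR_ge0.
  rewrite -fsbig_ord/=.
  apply: (@le_trans _ _ (\sum_(i < size l)
      ((2 * (nth (x0, 0) l i).2) `^ s)%:E)%E).
    apply: lee_sum => i _; have [/andP[d1 _] d2] := UP i (ltn_ord i).
    move: d1 d2; case: (diam (U i)) => // d; rewrite !lee_fin => d1 d2.
    have d0 : 0 <= d by apply: le_trans d1; exact: ltW.
    by rewrite ge0_ler_powR// nnegrE (le_trans d0 d2).
  by rewrite sumEFin lee_fin; move: lK; rewrite (big_nth (x0, 0)) big_mkord.
Qed.

End covers.

(** * Replacing a cover by balls with radii in a prescribed range *)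

Section refinement.
Context {R : realType} {X : metricType R}.
Implicit Types (F G P U : set X) (x y : X).

Definition assouad_bound F (a C : R) :=
  forall x (r rho : R), F x -> 0 < r -> r < rho ->
    (covering_number r (ball x rho `&` F) <= (C * (rho / r) `^ a)%:E)%E.

Lemma assouad_ball_cover F (a C : R) x (u rho lo hi q : R) :
  0 < C -> assouad_bound F a C -> F x -> 0 < u -> 2 * u < rho ->
  lo <= u <= hi ->
  ball_cover (ball x rho `&` F) lo hi q
    (2 * C * (rho / (2 * u)) `^ a * (2 * u) `^ q).
Proof.
move=> C0 FC Fx u0 urho uP.
have K0 : 0 < C * (rho / (2 * u)) `^ a.
  by rewrite mulr_gt0// powR_gt0// divr_gt0//; lra.
(* The factor 2 makes the bound on the infimum strict, so that an actual family of balls realises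
   it. *)
have [|s Gs sK] := covering_number_lt (2 * u) (2 * C * (rho / (2 * u)) `^ a)
    (ball x rho `&` F).
  apply: le_lt_trans (FC x (2 * u) rho Fx _ urho) _; first by lra.
  by rewrite lte_fin; lra.
apply: ball_cover_sub (ball_cover_same_radius (ball x rho `&` F) s u lo hi q uP _).
- by [].
- by rewrite ler_wpM2r// powR_ge0.
- move=> y /Gs[z zs zy]; exists z => //; move: zy.
  by rewrite mulrAC mulfV ?mul1r// pnatr_eq0.
Qed.

(** If [w / c <= delta / 2], boundedly many balls of radius [w / c] suffice, and [w ^ q <= w ^ s]
    because [w <= 1]. Otherwise about [(w / delta) ^ a] balls of radius [delta / 2] are used, at a
    cost of order [w ^ a * delta ^ (q - a)]; the hypothesis on [delta'] and [delta] bounds this by a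
    multiple of [w ^ s]. The constant is the sum of those of the two cases. *)
Lemma large_piece F U (a C c s q rho delta delta' w : R) :
  0 < C -> assouad_bound F a C -> 0 < c < 1 -> s <= q -> s <= a ->
  0 < rho -> rho <= w -> w <= delta' -> delta' <= 1 -> 0 < delta ->
  rho / c <= delta / 2 ->
  delta' `^ (a - s) * delta `^ (q - a) <= 1 ->
  U `<=` F -> (forall y z, U y -> U z -> mdist y z <= w) ->
  ball_cover [set y | F y /\ exists2 z, U z & mdist z y < rho]
    (rho / c) (delta / 2) q
    (2 * C * (2 `^ a * (2 / c) `^ q + (4 / c) `^ a) * w `^ s).
Proof.
move=> C0 FC /andP[c0 c1] sq sa rho0 rhow wd' d'1 d0 rhod dd UF Uw.
have w0 : 0 < w by lra.
have [[z Uz]|U0] := pselect (U !=set0); last first.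
  apply: ball_cover_sub (ball_cover0 _ _ _) => [y [_ [z Uz _]]|].
    by case: U0; exists z.
  by rewrite !mulr_ge0 ?addr_ge0 ?mulr_ge0 ?powR_ge0//; lra.
have wc : w < w / c by rewrite ltr_pdivlMr// gtr_pMr.
have rc : rho / c <= w / c by rewrite ler_pM2r// invr_gt0.
have rc0 : 0 < rho / c by rewrite divr_gt0.
pose u := Num.min (w / c) (delta / 2).
have uP : rho / c <= u <= delta / 2 by rewrite le_min rc rhod ge_min lexx orbT.
have u0 : 0 < u by lra.
have uw : 2 * u < 4 * (w / c).
  have : u <= w / c by rewrite ge_min lexx.
  by lra.
apply: ball_cover_sub (assouad_ball_cover F a C z u _ _ _ q C0 FC (UF z Uz) u0 uw uP).
  move=> y [Fy [v Uv vy]]; split => //; apply/in_ball.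
  by have := metric_triangle z v y; have := Uw z v Uz Uv; lra.
rewrite -[leLHS]mulrA -[leRHS]mulrA ler_pM2l ?mulr_gt0//.
have wq0 := powR_ge0 w s.
have c20 : 0 <= 2 / c by rewrite divr_ge0// ltW.
have c40 : 0 <= 4 / c by rewrite divr_ge0// ltW.
rewrite [leRHS]mulrDl /u; case: (leP (w / c) (delta / 2)) => _.
- have -> : 4 * (w / c) / (2 * (w / c)) = 2.
    by field; rewrite (gt_eqF w0) (gt_eqF c0).
  have -> : 2 * (w / c) = 2 / c * w by ring.
  rewrite (powRM _ c20 (ltW w0)) mulrA.
  apply: (@le_trans _ _ (2 `^ a * (2 / c) `^ q * w `^ s)).
    rewrite ler_wpM2l ?mulr_ge0 ?powR_ge0//.
    by apply: ger_powR => //; lra.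
  by rewrite lerDl mulr_ge0 ?powR_ge0.
- have -> : 4 * (w / c) / (2 * (delta / 2)) = 4 / c * (w * delta^-1).
    by field; rewrite (gt_eqF d0) (gt_eqF c0).
  have -> : 2 * (delta / 2) = delta by field.
  have di0 : 0 <= delta^-1 by rewrite invr_ge0 ltW.
  rewrite (powRM _ c40) ?mulr_ge0 ?(ltW w0)// (powRM _ (ltW w0) di0).
  apply: (@le_trans _ _ ((4 / c) `^ a * w `^ s)); last first.
    by rewrite lerDr !mulr_ge0 ?powR_ge0.
  rewrite -mulrA ler_wpM2l ?powR_ge0//.
  have -> : w `^ a = w `^ s * w `^ (a - s).
    by rewrite -powRD ?(gt_eqF w0) ?implybT//; congr (_ `^ _); ring.
  rewrite -!mulrA ler_piMr//.
  rewrite -(powR_inv1 (ltW d0)) -powRrM mulN1r -powRD; last first.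
    by rewrite (gt_eqF d0) implybT.
  rewrite (addrC (- a)); apply: le_trans dd; rewrite ler_wpM2r ?powR_ge0//.
  by rewrite ge0_ler_powR ?subr_ge0 ?nnegrE//; lra.
Qed.

(** Sets of weight below [rho] cannot meet two [rho]-balls around [4 * rho]-separated points, so the
    content bounds of these balls add up and limit the size of the family. Since [w i >= phi], the
    power [s] is compared with [lam] at the price of [phi ^ (s - lam)], which the hypothesis on
    [rho] and [phi] compensates. *)
Lemma small_rest F P (J : eqType) (I : seq J) (U : J -> set X) (w : J -> R)
    (c c0 lam s q rho phi delta eps : R) :
  0 < c < 1 -> 0 < c0 -> content_bound F lam c0 ->
  0 < rho -> (rho%:E <= diam F)%E -> 4 * (rho / c) <= delta / 2 ->
  0 < phi -> lam <= s -> rho `^ (q - lam) <= phi `^ (s - lam) ->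
  P `<=` F ->
  (forall x y, P x -> ball x rho y -> F y -> exists2 i, i \in I & U i y) ->
  (forall i, i \in I -> phi <= w i < rho) ->
  (forall i y z, i \in I -> U i y -> U i z -> mdist y z <= w i) ->
  \sum_(i <- I) w i `^ s <= eps ->
  ball_cover P (rho / c) (delta / 2) q ((8 / c) `^ q / c0 * eps).
Proof.
move=> /andP[cc0 c1] c00 Fc0 rho0 rhoF rhod phi0 lams rhophi PF Pcov wP diamU sumU.
(* The least share of the sum that belongs to one point of a separated family. *)
pose m := c0 * rho `^ lam * phi `^ (s - lam).
have m0 : 0 < m by rewrite !mulr_gt0 ?powR_gt0.
have bound (l : seq X) : [set` l] `<=` P ->
    pairwise (fun x y => 4 * rho <= mdist x y) l -> (size l)%:R * m <= eps.
  move=> lP ll; apply: le_trans sumU.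
  apply: (@le_trans _ _ (phi `^ (s - lam) * \sum_(i <- I) w i `^ lam)).
    rewrite /m [c0 * _ * _]mulrC mulrCA ler_wpM2l ?powR_ge0//.
    apply: (@le_trans _ _ (\sum_(x <- l)
        \sum_(i <- I | `[< U i `&` ball x rho !=set0 >]) w i `^ lam)).
      rewrite -(sum_const_seq _ l) big_seq [leRHS]big_seq.
      apply: ler_sum => x xl; have Px := lP x xl.
      apply: (Fc0 x rho J I U w (PF x Px) rho0 rhoF) => //.
      + by move=> y; exact: Pcov.
      + by move=> i /wP/andP[+ _]; exact: lt_le_trans.
    apply: (sum_pairwise_disjoint (fun x y => 4 * rho <= mdist x y)) => //.
    + by move=> i; exact: powR_ge0.
    + move=> x y i _ xy iI /asboolP[p [Up /in_ball xp]].
      apply/asboolP => -[v [Uv /in_ball yv]].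
      have := diamU i p v iI Up Uv; have /andP[_] := wP i iI.
      have := metric_triangle x p y; have := metric_triangle p v y.
      by rewrite (metric_sym v y); lra.
  rewrite mulr_sumr big_seq [leRHS]big_seq; apply: ler_sum => i /wP/andP[pw _].
  have w0 : 0 < w i by exact: lt_le_trans pw.
  have -> : w i `^ s = w i `^ (s - lam) * w i `^ lam.
    by rewrite -powRD ?(gt_eqF w0) ?implybT//; congr (_ `^ _); ring.
  by rewrite ler_wpM2r ?powR_ge0// ge0_ler_powR ?subr_ge0 ?nnegrE ?(ltW w0) ?(ltW phi0).
(* More than [eps / m] separated points would contradict [bound], so the greedy choice ends with a
   net. *)
pose n := (Num.truncn (eps / m)).+1.
have [l [lP ll lmax]] := separated_or_maximal P (4 * rho) n ltac:(lra).
have lm := bound l lP ll.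
have {}lmax x : P x -> exists2 y, y \in l & mdist y x < 4 * rho.
  case: lmax => [ln|lmax]; last exact: lmax.
  by move: lm; rewrite ln -ler_pdivlMr// leNgt truncnS_gt.
have rhoc : rho < rho / c by rewrite ltr_pdivlMr// gtr_pMr.
(* The radius is [4 * (rho / c)] instead of [4 * rho] in order to stay above the lower limit
   [rho / c]. *)
have uP : rho / c <= 4 * (rho / c) <= delta / 2 by apply/andP; split => //; lra.
apply: ball_cover_sub (ball_cover_same_radius P l _ _ _ q uP _) => //.
- have -> : 2 * (4 * (rho / c)) = 8 / c * rho by ring.
  have c80 : 0 <= 8 / c by rewrite divr_ge0// ltW.
  rewrite (powRM _ c80 (ltW rho0)) mulrCA -mulrA ler_wpM2l ?powR_ge0//.
  rewrite ler_pdivlMl//; apply: le_trans lm.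
  rewrite mulrCA ler_wpM2l// /m -mulrA ler_pM2l//.
  have -> : rho `^ q = rho `^ lam * rho `^ (q - lam).
    by rewrite -powRD ?(gt_eqF rho0) ?implybT//; congr (_ `^ _); ring.
  by rewrite ler_wpM2l ?powR_ge0.
- move=> y /lmax[x xl xy]; exists x => //; apply/in_ball; lra.
Qed.

(** The cover is split at weight [rho]. A point outside the [rho]-neighbourhoods of the large pieces
    has a [rho]-ball that no large piece meets, so within [F] the small sets alone cover that
    ball. *)
Lemma refine_cover F (J : eqType) (I : seq J) (U : J -> set X) (w : J -> R)
    (a C c c0 lam s q rho phi delta delta' eps : R) :
  0 < C -> assouad_bound F a C -> 0 < c < 1 ->
  0 < c0 -> content_bound F lam c0 ->
  lam <= s -> s <= q -> s <= a ->
  0 < rho -> (rho%:E <= diam F)%E -> 4 * (rho / c) <= delta / 2 ->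
  0 < delta -> delta' <= 1 -> 0 < phi ->
  delta' `^ (a - s) * delta `^ (q - a) <= 1 ->
  rho `^ (q - lam) <= phi `^ (s - lam) ->
  finite_cover F I U w ->
  (forall i, i \in I -> phi <= w i <= delta') ->
  \sum_(i <- I) w i `^ s <= eps ->
  ball_cover F (rho / c) (delta / 2) q
    ((2 * C * (2 `^ a * (2 / c) `^ q + (4 / c) `^ a) + (8 / c) `^ q / c0) * eps).
Proof.
move=> C0 FC cP c00 Fc0 lams sq sa rho0 rhoF rhod d0 d'1 phi0 dd rhophi.
move=> [FU diamU] wP sumU; have /andP[cc0 c1] := cP.
have rc0 : 0 < rho / c by rewrite divr_gt0.
set K1 := 2 * C * _; set K2 := _ / c0.
have K10 : 0 <= K1.
  by rewrite !mulr_ge0 ?addr_ge0 ?mulr_ge0 ?powR_ge0//; lra.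
pose V i := U i `&` F.
pose N i := [set y | F y /\ exists2 z, V i z & mdist z y < rho].
pose I1 := [seq i <- I | rho <= w i]; pose I2 := [seq i <- I | w i < rho].
pose P := F `\` [set y | exists2 i, i \in I1 & N i y].
have large : ball_cover [set y | exists2 i, i \in I1 & N i y] (rho / c) (delta / 2) q
    (\sum_(i <- I1) K1 * w i `^ s).
  apply: ball_cover_bigcup => i; rewrite mem_filter => /andP[rw iI].
  have /andP[_ wd'] := wP i iI.
  apply: (large_piece F (V i) a C c s q rho delta delta' (w i)) => //.
  + by lra.
  + by move=> y [].
  + by move=> y z [Uy _] [Uz _]; exact: (diamU i).
have small : ball_cover P (rho / c) (delta / 2) q (K2 * eps).
  apply: (small_rest F P J I2 V w c c0 lam s q rho phi delta eps) => //.
  + by move=> y [].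
  + move=> x y [Fx xN] /in_ball xy Fy; have [i iI Uy] := FU y Fy.
    exists i => //; rewrite mem_filter iI andbT ltNge; apply/negP => rw.
    apply: xN; exists i; first by rewrite mem_filter rw.
    by split => //; exists y => //; rewrite metric_sym.
  + by move=> i; rewrite mem_filter => /andP[-> /wP/andP[-> _]].
  + move=> i y z; rewrite mem_filter => /andP[_ iI] [Uy _] [Uz _].
    exact: (diamU i).
  + apply: le_trans sumU; rewrite big_filter big_mkcond /=.
    by apply: ler_sum => i _; case: ifP => // _; exact: powR_ge0.
apply: ball_cover_sub (ball_coverU _ _ _ _ _ _ _ large small).
- move=> y Fy; have [yN|yN] := pselect (exists2 i, i \in I1 & N i y).
    by left.
  by right.
- rewrite mulrDl lerD2r -mulr_sumr ler_wpM2l//; apply: le_trans sumU.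
  rewrite big_filter big_mkcond /=.
  by apply: ler_sum => i _; case: ifP => // _; exact: powR_ge0.
Qed.

End refinement.

(** * Comparison of the dimensions and transfer of covers between scales *)

Lemma near_0rightP {R : realType} (P : R -> Prop) :
  (\forall t \near 0^'+, P t) ->
  exists2 e : R, 0 < e & forall t, 0 < t < e -> P t.
Proof.
move=> [e /= e0 eP]; exists e => // t /andP[t0 te]; apply: eP => //=.
by rewrite sub0r normrN gtr0_norm.
Qed.

Section dimension_lemmas.
Context {R : realType} {X : metricType R}.
Implicit Types (F : set X) (x y : X).

(** If all distances in [F] vanish, one ball always suffices and the exponent 0 is allowed. *)
Lemma assouad_dim_gt0_nontrivial F : (0 < assouad_dim F)%E ->
  exists x y, [/\ F x, F y & 0 < mdist x y].
Proof.
move=> dimF; apply: contrapT => trivF.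
suff : (assouad_dim F <= 0)%E by rewrite leNgt dimF.
apply: ereal_inf_lbound; exists 0 => //; exists 1 => // x r rho Fx r0 rrho.
rewrite powRr0 mulr1; apply: ereal_inf_lbound; exists [:: x] => //; split.
  move=> y /=; rewrite inE => /eqP->; split => //; apply: ballxx.
  exact: lt_trans rrho.
move=> y [_ Fy]; exists x; first by rewrite /= mem_head.
apply/in_ball; rewrite ltNge; apply/negP => xy; apply: trivF.
by exists x, y; split => //; apply: lt_le_trans xy; lra.
Qed.

(** The content bound for one ball, with the distance to a second point as radius, is independent of
    [Phi] and [delta]. *)
Lemma no_small_cover_below_lower_dim F (s : R) : 0 <= s ->
  (s%:E < lower_dim F)%E -> (exists x y, [/\ F x, F y & 0 < mdist x y]) ->
  exists2 eps : R, 0 < eps & forall (Phi : R -> R) (delta : R),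
    0 < Phi delta -> ~ has_cover Phi F s eps delta.
Proof.
move=> s0 sF [x [y [Fx Fy xy]]].
have [|c c0 Fc] := lower_content F s.
  by move: s0; rewrite le_eqVlt => /orP[/eqP<-|s0]; [left|right].
exists (c * mdist x y `^ s / 2); first by rewrite !mulr_gt0 ?powR_gt0.
move=> Phi delta Phi0 /(has_cover_finite _ _ _ _ _ s0 Phi0)[I [U [w [[FU Uw] wP]]]].
apply/negP; rewrite -ltNge.
have K0 : 0 < c * mdist x y `^ s by rewrite mulr_gt0 ?powR_gt0.
apply: (@lt_le_trans _ _ (c * mdist x y `^ s)); first by lra.
apply: le_trans (Fc x (mdist x y) _ I U w Fx xy (mdist_diam F x y Fx Fy) _ _ Uw) _.
- by move=> z _; exact: FU.
- by move=> i /wP/andP[+ _]; exact: lt_le_trans.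
- rewrite big_mkcond; apply: ler_sum => i _; case: ifP => // _.
  exact: powR_ge0.
Qed.

Lemma lower_dim_le_upper_phi_dim (Delta : R) (Phi : R -> R) F :
  admissible Delta Phi -> (exists x y, [/\ F x, F y & 0 < mdist x y]) ->
  (lower_dim F <= upper_phi_dim Delta Phi F)%E.
Proof.
move=> [Delta0 _ PhiP _] F2; apply: le_ereal_inf_tmp => _ [s [s0 sP] <-].
rewrite leNgt; apply/negP => sF.
have [eps eps0 nocover] := no_small_cover_below_lower_dim F s s0 sF F2.
have [d0 /andP[d00 _] d0P] := sP eps eps0.
pose delta := Num.min d0 Delta / 2.
have m0 : 0 < Num.min d0 Delta by rewrite lt_min d00.
have [md mD] : Num.min d0 Delta <= d0 /\ Num.min d0 Delta <= Delta.
  by rewrite !ge_min !lexx orbT.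
apply: (nocover Phi delta); last by apply: d0P; rewrite /delta; lra.
by have /andP[] : 0 < Phi delta <= delta by apply: PhiP; rewrite /delta; lra.
Qed.

Lemma lower_dim_le_lower_phi_dim (Delta : R) (Phi : R -> R) F :
  admissible Delta Phi -> (exists x y, [/\ F x, F y & 0 < mdist x y]) ->
  (lower_dim F <= lower_phi_dim Delta Phi F)%E.
Proof.
move=> [Delta0 _ PhiP _] F2; apply: le_ereal_inf_tmp => _ [s [s0 sP] <-].
rewrite leNgt; apply/negP => sF.
have [eps eps0 nocover] := no_small_cover_below_lower_dim F s s0 sF F2.
have [|delta [/andP[d0 _] dD]] := sP eps 1 eps0; first by rewrite ltr01 lexx.
apply: nocover.
by have /andP[] : 0 < Phi delta <= delta by apply: PhiP; rewrite d0.
Qed.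

(** For [L > 0] an exponent slightly below [L] is taken, kept positive by [L / 2]; otherwise the
    exponent 0 serves. *)
Lemma exists_content_exponent F (L kappa : R) :
  0 < kappa -> L = fine (lower_dim F) -> (lower_dim F < +oo)%E ->
  exists lam : R, [/\ L - kappa < lam, lam <= Num.max L 0 &
    exists2 c : R, 0 < c & content_bound F lam c].
Proof.
move=> k0 LE Loo; have [L0|L0] := ltP 0 L; last first.
  exists 0; split; rewrite ?le_max ?lexx ?orbT//; first by lra.
  by apply: lower_content; left.
have LF : lower_dim F = L%:E.
  by move: L0 Loo; rewrite LE; case: (lower_dim F) => //=; rewrite ltxx.
have [lam1 lam2] : L - kappa / 2 <= Num.max (L - kappa / 2) (L / 2) /\
    L / 2 <= Num.max (L - kappa / 2) (L / 2).
  by rewrite !le_max !lexx orbT.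
have lamL : Num.max (L - kappa / 2) (L / 2) < L by rewrite gt_max; lra.
exists (Num.max (L - kappa / 2) (L / 2)); split; first by lra.
  exact: ltW.
by apply: lower_content; right; split; [lra|rewrite LF lte_fin].
Qed.

(** The comparison at a single [delta], common to the upper and the lower dimension. The exponents
    [s], [a] and [lam] only approximate [d], [A] and [L]; the slack [tau] absorbs the errors. *)
Lemma cover_transfer (Delta Delta1 : R) (Phi Phi1 : R -> R) F
    (d A L eta tau : R) (gamma := (d - L) / (d + eta - L))
    (alpha := (A - d) / (A - d - eta)) :
  uniformly_perfect X -> admissible Delta Phi -> admissible Delta1 Phi1 ->
  (exists x y, [/\ F x, F y & 0 < mdist x y]) ->
  assouad_dim F = A%:E -> L = fine (lower_dim F) -> (lower_dim F < +oo)%E ->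
  0 < d -> L < d -> 0 <= eta -> eta < A - d -> 0 < tau ->
  (\forall delta \near 0^'+, Phi1 delta <= Phi (delta `^ (1 / alpha)) `^ gamma) ->
  exists2 kappa : R, 0 < kappa & forall s, d <= s < d + kappa ->
    exists2 K : R, 0 < K &
      \forall delta \near 0^'+, delta < Delta1 /\ forall eps,
        has_cover Phi F s eps (delta `^ (1 / alpha)) ->
        has_cover Phi1 F (d + eta + tau) (K * eps) delta.
Proof.
move=> [c cP perf] [Delta0 _ PhiP _] [Delta10 _ Phi1P Phi1lim] F2 AE LE Loo.
move=> d0 Ld eta0 etaA tau0 Phi1Phi; have /andP[c0 c1] := cP.
pose beta := 1 / alpha.
have beta_d : beta * (A - d) = A - d - eta.
  by rewrite /beta /alpha; field; apply/andP; split; rewrite gt_eqF//; lra.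
have beta0 : 0 < beta by rewrite /beta /alpha !divr_gt0//; lra.
have beta1 : beta <= 1 by nra.
have gamma_d : gamma * (d + eta - L) = d - L.
  by rewrite /gamma; field; rewrite gt_eqF//; lra.
have gamma0 : 0 < gamma by rewrite /gamma !divr_gt0//; lra.
have gamma1 : gamma <= 1 by nra.
have gt0 : 0 < gamma * tau by rewrite mulr_gt0.
have gtau : gamma * tau <= tau by rewrite ger_pMl.
(* In [exp2] two errors below [kappa] must fit into [gamma * tau], whence the factor 1/2;
   [kappa <= A - d] ensures [s <= a]. *)
pose kappa := Num.min (gamma * tau / 2) (A - d).
have k0 : 0 < kappa by rewrite lt_min; lra.
have [k1 k2] : kappa <= gamma * tau / 2 /\ kappa <= A - d.
  by rewrite !ge_min !lexx orbT.
exists kappa => // s /andP[ds sd].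
have [a aP aA] : exists2 a, (exists2 C, 0 < C & assouad_bound F a C) &
    A <= a < A + kappa.
  have : (assouad_dim F < (A + kappa)%:E)%E by rewrite AE lte_fin; lra.
  move=> /ereal_inf_lt[_ [a [C C0 FC] <-]]; rewrite lte_fin => aA.
  exists a; first by exists C.
  rewrite aA andbT -lee_fin -AE; apply: ereal_inf_lbound.
  by exists a => //; exists C.
have [C C0 FC] := aP; have /andP[aA1 aA2] := aA.
have [lam [lam1 lam2 [c2 c20 Fc2]]] := exists_content_exponent F L kappa k0 LE Loo.
have lams : lam <= s by apply: le_trans lam2 _; rewrite ge_max; lra.
set q := d + eta + tau.
pose K := 2 * C * (2 `^ a * (2 / c) `^ q + (4 / c) `^ a) + (8 / c) `^ q / c2.
have K0 : 0 < K.
  rewrite addr_gt0 ?mulr_gt0 ?addr_gt0 ?mulr_gt0 ?invr_gt0 ?powR_gt0//;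
    by rewrite divr_gt0.
(* The choice of [alpha] cancels the main terms; what remains is [tau] minus a weighted mean of
   [s - d] and [a - A]. *)
have exp1 : 0 <= beta * (a - s) + (q - a).
  have -> : beta * (a - s) + (q - a) =
    beta * (A - d) - (A - d - eta) + tau - beta * (s - d) - (1 - beta) * (a - A).
    by rewrite /q; ring.
  rewrite beta_d subrr add0r; nra.
(* The choice of [gamma] turns the main term into [d - L]. *)
have exp2 : s - lam <= gamma * (q - lam).
  have -> : gamma * (q - lam) =
    gamma * (d + eta - L) + gamma * tau - gamma * (lam - L) by rewrite /q; ring.
  rewrite gamma_d; nra.
exists K => //.
have [x [y [Fx Fy xy]]] := F2.
near=> delta.
have dl0 : 0 < delta by near: delta; exact: nbhs_right_gt.
have dl1 : delta < 1 by near: delta; exact: nbhs_right_lt.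
have dlD1 : delta < Delta1 by near: delta; exact: nbhs_right_lt.
(* This keeps [delta / 2] below the diameter of [X] and [Phi1 delta] below that of [F]. *)
have dlxy : delta < mdist x y by near: delta; exact: nbhs_right_lt.
have dlPhi : Phi1 delta <= Phi (delta `^ beta) `^ gamma by near: delta.
have dlD : delta `^ beta < Delta.
  near: delta; exact: cvgr_lt (powR_cvg0 beta0) _ Delta0.
(* The constant [c / 8] gives [4 * (Phi1 delta / c) <= delta / 2]. *)
have dlc : Phi1 delta / delta < c / 8.
  by near: delta; apply: cvgr_lt Phi1lim _ _; rewrite divr_gt0.
split => // eps.
have dl'0 : 0 < delta `^ beta by exact: powR_gt0.
have dl'1 : delta `^ beta <= 1.
  by rewrite -(powRr0 delta); apply: ger_powR; [lra|exact: ltW].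
have /andP[phi0 phid] : 0 < Phi (delta `^ beta) <= delta `^ beta.
  by apply: PhiP; rewrite dl'0.
have /andP[rho0 rhod] : 0 < Phi1 delta <= delta by apply: Phi1P; rewrite dl0.
have s0 : 0 <= s by lra.
move=> /(has_cover_finite _ _ _ _ _ s0 phi0)[I [U [w [FU wP sumU]]]].
have XF : ((mdist x y)%:E <= diam [set: X])%E by exact: mdist_diam.
apply: (has_cover_balls c) => //.
- by rewrite /q; lra.
- by apply: lt_le_trans XF; rewrite lte_fin; lra.
apply: (refine_cover F nat I U w a C c c2 lam s q (Phi1 delta)
  (Phi (delta `^ beta)) delta (delta `^ beta) eps) => //.
- by rewrite /q; lra.
- by lra.
- by apply: le_trans (mdist_diam F x y Fx Fy); rewrite lee_fin; lra.
- move: dlc; rewrite ltr_pdivrMr// => dlc.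
  by rewrite mulrA ler_pdivrMr//; lra.
- rewrite -powRrM -powRD ?(gt_eqF dl0) ?implybT//.
  rewrite -[leRHS](powRr0 delta); apply: ger_powR => //; lra.
- apply: (@le_trans _ _ ((Phi (delta `^ beta) `^ gamma) `^ (q - lam))).
    apply: ge0_ler_powR; rewrite ?nnegrE ?powR_ge0 ?(ltW rho0)//.
    by rewrite /q; lra.
  by rewrite -powRrM; apply: ger_powR => //; lra.
Unshelve. all: by end_near.
Qed.

End dimension_lemmas.

Theorem theorem3p5 (R : realType) (X : metricType R)
    (Delta Delta1 : R) (Phi Phi1 : R -> R) (F : set X)
    (X_perfect : uniformly_perfect X)
    (X_nontrivial : exists x y : X, x <> y)
    (Phi_adm : admissible Delta Phi) (Phi1_adm : admissible Delta1 Phi1)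
    (F_neq0 : F !=set0) (F_tb : totally_bounded F)
    (F_dimA : (0 < assouad_dim F < +oo)%E)
    (F_complete : complete_set (closure F)) :
  (let D := upper_phi_dim Delta Phi F in
   let d := fine D in
   let A := fine (assouad_dim F) in
   let L := fine (lower_dim F) in
   (0 < D < assouad_dim F)%E ->
   lower_dim F <> D ->
   forall eta : R, 0 <= eta -> (eta%:E < assouad_dim F - D)%E ->
   let gamma := (d - L) / (d + eta - L) in
   let alpha := (A - d) / (A - d - eta) in
   (\forall delta \near 0^'+, Phi1 delta <= Phi (delta `^ (1 / alpha)) `^ gamma) ->
   (upper_phi_dim Delta1 Phi1 F <= D + eta%:E)%E)
  /\
  (let D := lower_phi_dim Delta Phi F in
   let d := fine D in
   let A := fine (assouad_dim F) in
   let L := fine (lower_dim F) in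
   (0 < D < assouad_dim F)%E ->
   lower_dim F <> D ->
   forall eta : R, 0 <= eta -> (eta%:E < assouad_dim F - D)%E ->
   let gamma := (d - L) / (d + eta - L) in
   let alpha := (A - d) / (A - d - eta) in
   (\forall delta \near 0^'+, Phi1 delta <= Phi (delta `^ (1 / alpha)) `^ gamma) ->
   (lower_phi_dim Delta1 Phi1 F <= D + eta%:E)%E).
Proof.
have F2 := assouad_dim_gt0_nontrivial F (proj1 (andP F_dimA)).
have AE : assouad_dim F = (fine (assouad_dim F))%:E.
  by rewrite fineK// fin_real//; case/andP: F_dimA => /(lt_trans (ltNyr 0))->.
split=> D d A L /andP[D0 DA] LD eta eta0 etaA gamma alpha Phi1Phi.
all: have DE : D = d%:E by
  rewrite /d fineK// fin_real// (lt_trans (ltNyr 0) D0)/= (lt_le_trans DA) ?leey.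
all: have [d0 dA] : 0 < d /\ d < A
  by move: D0 DA; rewrite AE DE !lte_fin.
all: have etaA' : eta < A - d by move: etaA; rewrite AE DE -EFinB lte_fin.
all: have alpha0 : 0 < 1 / alpha by rewrite /alpha !divr_gt0//; lra.
all: have LleD : (lower_dim F <= D)%E by
  [exact: lower_dim_le_upper_phi_dim | exact: lower_dim_le_lower_phi_dim].
all: have Loo : (lower_dim F < +oo)%E by rewrite (le_lt_trans LleD)// DE ltry.
(* For a real lower dimension [LD] makes the inequality strict; at [-oo], [fine] returns 0 and [d0]
   applies. *)
all: have Ld : L < d by
  move: LleD LD; rewrite DE /L; case: (lower_dim F) => [l| |] //=;
  rewrite lee_fin le_eqVlt => /orP[/eqP->|].
all: apply/lee_addgt0Pr => tau tau0; rewrite DE -!EFinD.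
all: have [k k0 kP] := cover_transfer Delta Delta1 Phi Phi1 F d A L eta tau
  X_perfect Phi_adm Phi1_adm F2 AE erefl Loo d0 Ld eta0 etaA' tau0 Phi1Phi.
all: have : (D < (d + k)%:E)%E by rewrite DE lte_fin ltrDl.
all: move=> /ereal_inf_lt[_ [s [s0 sP] <-]]; rewrite lte_fin => sk.
all: have ds : d <= s by
  rewrite -lee_fin -DE; apply: ereal_inf_lbound; exists s.
all: have [|K K0 transfer] := kP s; first by rewrite ds.
all: apply: ereal_inf_lbound; exists (d + eta + tau) => //; split; first by lra.
(* Upper dimension: every small [delta] is treated through the cover at [delta ^ (1 / alpha)], which
   also tends to 0. *)
- move=> eps eps0; have [Delta0 _ _ _] := Phi_adm.
  have [delta1 /andP[delta10 _] cover1] := sP (eps / K) (divr_gt0 eps0 K0).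
  have [|e e0 eP] := near_0rightP (fun delta => (delta < Delta1 /\
      has_cover Phi1 F (d + eta + tau) eps delta)).
    near=> delta.
    have [dD1 tr] : delta < Delta1 /\ forall eps,
        has_cover Phi F s eps (delta `^ (1 / alpha)) ->
        has_cover Phi1 F (d + eta + tau) (K * eps) delta by near: delta.
    split => //; rewrite -(mulfVK (lt0r_neq0 K0) eps) mulrC; apply: tr.
    apply: cover1.
      rewrite powR_gt0; last by near: delta; exact: nbhs_right_gt.
      by near: delta; exact: cvgr_lt (powR_cvg0 alpha0) _ delta10.
    by near: delta; exact: cvgr_lt (powR_cvg0 alpha0) _ Delta0.
  exists (Num.min e 1); first by rewrite lt_min e0 ltr01 ge_min lexx orbT.
  move=> delta /andP[delta0]; rewrite lt_min => /andP[de _] _.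
  by apply eP; rewrite delta0.
(* Lower dimension: the good scale [delta'] is given, and [delta' ^ alpha] is the scale sought. The
   threshold [t ^ (1 / alpha)] for [delta'] brings it below [t]. *)
- move=> eps delta0 eps0 /andP[delta00 delta01].
  have [e e0 eP] := near_0rightP _ transfer.
  pose t := Num.min e delta0.
  have t0 : 0 < t by rewrite lt_min e0.
  have [te td] : t <= e /\ t <= delta0 by rewrite !ge_min !lexx orbT.
  have t1 : t <= 1 by lra.
  have tb : 0 < t `^ (1 / alpha) <= 1.
    by rewrite powR_gt0//= -[leRHS](powRr0 t) ger_powR ?t0// ltW.
  have [delta' [/andP[d'0 d't] d'D cover']] := sP _ _ (divr_gt0 eps0 K0) tb.
  have alpha00 : 0 < alpha by move: alpha0; rewrite div1r invr_gt0.
  have alphaK u : 0 <= u -> (u `^ (1 / alpha)) `^ alpha = u.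
    by move=> u0; rewrite -powRrM div1r mulVf ?gt_eqF// powRr1.
  have dt : delta' `^ alpha < t.
    rewrite -[ltRHS]alphaK ?(ltW t0)//.
    by rewrite gt0_ltr_powR// nnegrE ?powR_ge0 ?(ltW d'0).
  have dl0 : 0 < delta' `^ alpha by exact: powR_gt0.
  have [|dD1 tr] := eP (delta' `^ alpha); first by rewrite dl0; lra.
  exists (delta' `^ alpha); split => //; first by rewrite dl0; lra.
  rewrite -(mulfVK (lt0r_neq0 K0) eps) mulrC; apply: tr.
  by rewrite -powRrM div1r mulfV ?gt_eqF// powRr1 ?(ltW d'0).
Unshelve. all: by end_near.
Qed.
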